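(* For every integer $n\ge0$, $$\sum_{\alpha\in\mathcal{P}^{\le n+1}}x^{\mathrm{col}(\alpha)}y^{\mathrm{row}(\alpha)}q^{\mathrm{area}(\alpha)}=-\frac{x\displaystyle\sum_{k=0}^n\sum_{a=0}^{n-k}(-1)^kx^ay^{-k-a}q^{-\binom k2-2k}\begin{bmatrix}k+a\\ a\end{bmatrix}_{q^{-1}}\begin{bmatrix}n-a\\ k\end{bmatrix}_{q^{-1}}}{\displaystyle\sum_{k=0}^{n+1}\sum_{a=0}^{n+1-k}(-1)^kx^ay^{-k-a}q^{-\binom k2-k}\begin{bmatrix}k+a\\ a\end{bmatrix}_{q^{-1}}\begin{bmatrix}n+1-a\\ k\end{bmatrix}_{q^{-1}}}.$$
   Context: $x,y,q$ are indeterminates; the left-hand side is a formal power series, equal to the rational function on the right. $\begin{bmatrix}N\\ k\end{bmatrix}_{p}=\prod_{i=1}^{k}\frac{1-p^{N-k+i}}{1-p^i}$ is the Gaussian binomial coefficient in base $p$; here $p=q^{-1}$. An NE-path is a lattice path from $(0,0)$ to $(s,t)$, for positive integers $s,t$, consisting of north steps $(0,1)$ and east steps $(1,0)$. A parallelogram polyomino is the set of unit squares enclosed by two NE-paths with the same ending point that do not intersect except at the starting and ending points. For a parallelogram polyomino $\alpha$, $\mathrm{col}(\alpha)$, $\mathrm{row}(\alpha)$ and $\mathrm{area}(\alpha)$ are its numbers of columns, rows and unit squares. A diagonal of $\alpha$ is the (nonempty) set of squares of $\alpha$ whose centers lie on a line $x+y=i$ for some integer $i$, and its size is its number of squares. $\mathcal{P}^{\le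 k}$ is the set of parallelogram polyominoes in which every diagonal has size at most $k$. *)

(* Defs.v *)
From HB Require Import structures.
From mathcomp Require Import all_boot all_order all_algebra.
From mathcomp Require Import finmap.
From mathcomp Require Import mpoly.

Set Implicit Arguments.
Unset Strict Implicit.
Unset Printing Implicit Defensive.

Import GRing.Theory.
Local Open Scope ring_scope.

(* The unit square [i, i+1] x [j, j+1] is encoded by its lower-left corner
   (i, j); lattice points and squares thus share the type nat * nat. *)

Definition ne_step : rel (nat * nat) :=
  fun u v => (v == (u.1.+1, u.2)) || (v == (u.1, u.2.+1)).

(* p lists the lattice points visited after the origin. *)
Definition ne_path (e : nat * nat) (p : seq (nat * nat)) : bool :=
  path ne_step (0, 0)%N p && (last (0, 0)%N p == e).

Definition visited (p : seq (nat * nat)) : seq (nat * nat) := (0, 0)%N :: p.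

(* p has the east step (i, h) -> (i+1, h) for some h <= j, where z = (i, j). *)
Definition passes_below (p : seq (nat * nat)) (z : nat * nat) : bool :=
  has (fun h => ((z.1, h) \in visited p) && ((z.1.+1, h) \in visited p))
      (iota 0 z.2.+1).

(* An NE-path crosses the vertical line through the centre of a square at most
   once, so a square is enclosed by the closed curve made of p1 and p2 iff
   exactly one of p1, p2 passes below it; which of p1, p2 is the lower path is
   not prescribed. *)
Definition parallelogram_polyomino (al : {fset nat * nat}) : Prop :=
  exists s t : nat, exists p1 p2 : seq (nat * nat),
    [/\ ((0 < s) && (0 < t))%N,
        ne_path (s, t) p1,
        ne_path (s, t) p2,
        forall z, z \in visited p1 -> z \in visited p2 ->
          z = (0, 0)%N \/ z = (s, t) &
        forall z, (z \in al) = passes_below p1 z (+) passes_below p2 z].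

Definition pcol (al : {fset nat * nat}) : nat :=
  #|` [fset z.1 | z in al]%fset |.

Definition prow (al : {fset nat * nat}) : nat :=
  #|` [fset z.2 | z in al]%fset |.

Definition area (al : {fset nat * nat}) : nat := #|` al |.

(* The centre of (i, j) is (i + 1/2, j + 1/2), which lies on x + y = i + j + 1;
   the lines with d <= 0 meet no square. *)
Definition diagonal (al : {fset nat * nat}) (d : nat) : {fset nat * nat} :=
  [fset z in al | (z.1 + z.2 + 1 == d)%N]%fset.

Definition parallelogram_le (k : nat) (al : {fset nat * nat}) : Prop :=
  parallelogram_polyomino al /\ forall d : nat, (#|` diagonal al d | <= k)%N.

(* x, y, q are the variables of index 0, 1, 2. *)
Definition weight (al : {fset nat * nat}) : 'X_{1..3} :=
  [multinom [tuple pcol al; prow al; area al]].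

(* Formal power series in x, y, q over the integers, by coefficients. *)
Definition fps : Type := 'X_{1..3} -> int.

(* f is the formal sum of the monomials w a over all a satisfying A; in
   particular each monomial arises from finitely many a. *)
Definition is_genfun (T : eqType) (A : T -> Prop) (w : T -> 'X_{1..3})
    (f : fps) : Prop :=
  forall m : 'X_{1..3}, exists s : seq T,
    [/\ uniq s, forall a, a \in s <-> (A a /\ w a = m) & f m = (size s)%:R].

Definition fps_mul_mpoly (Q : {mpoly int[3]}) (f : fps) : fps :=
  fun m => \sum_(m1 <- msupp Q | (m1 <= m)%MM) Q@_m1 * f (m - m1)%MM.

Definition ratfun : fieldType := {fraction {mpoly int[3]}}.

Definition ratvar (i : 'I_3) : ratfun := tofrac ('X_i : {mpoly int[3]}).

(* Power series over int form an integral domain, so this does not depend on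
   the chosen representation R = P / Q. *)
Definition fps_eq_ratfun (f : fps) (R : ratfun) : Prop :=
  exists P Q : {mpoly int[3]},
    [/\ Q != 0, R = tofrac P / tofrac Q & forall m, fps_mul_mpoly Q f m = P@_m].

(* The exponent N - k + i is taken in int. *)
Definition gauss_binom (F : fieldType) (p : F) (N k : nat) : F :=
  \prod_(1 <= i < k.+1) ((1 - p ^ (N%:Z - k%:Z + i%:Z)) / (1 - p ^+ i)).

(* Main.v *)
Require Import Defs.
From HB Require Import structures.
From mathcomp Require Import all_boot all_order all_algebra.
From mathcomp Require Import finmap.
From mathcomp Require Import mpoly.
From mathcomp Require Import ring zify.

Set Implicit Arguments.
Unset Strict Implicit.
Unset Printing Implicit Defensive.

Import GRing.Theory.
Local Open Scope ring_scope.

(** Read a parallelogram polyomino one antidiagonal at a time.  At time d both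
    boundary paths stand on the line x + y = d, and the horizontal distance
    between them is the number of squares of the d-th diagonal.  Each unit of
    time moves each path east or north, so this distance changes by at most one
    and the polyomino becomes a Motzkin walk that stays positive strictly
    between its two ends: up means lower path east and upper path north, down
    the converse, and there are two kinds of level steps.  Columns and rows are
    the east and north steps of the lower path, so up weighs x, down y, level x
    or y; the area is the sum of the heights; and diagonals of size at most N
    are heights at most N.  The passage between the two descriptions rests on
    [passes_below_trace]: a path passes below a square exactly when, at the time
    of that square's diagonal, it has made more east steps than the abscissa of
    the square ([enclosed_inj], [enclosed_polyomino], [polyomino_enclosed]).

    Let F_h be the series of walks that start at height h, stay in [1, N] and
    end on reaching 0, a vertex of height j weighing q^j.  Splitting off the
    first step gives
      F_h = q^h (x F_(h+1) + (x + y) F_h + y F_(h-1)),  F_0 = 1, F_(N+1) = 0,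
    and solving this tridiagonal system from the top yields
      D_h F_h = y q^h D_(h+1) F_(h-1)
    with continuants D_h = (1 - q^h (x + y)) D_(h+1) - x y q^(2h+1) D_(h+2).
    Hence D_1 (x F_1) = x y q D_2 ([walk_series_rational]), where x accounts for
    the first step of the polyomino.  No ring of power series is needed: bounding
    the length of the walks by L gives polynomials that satisfy the system up to
    terms of degree at least L.

    It remains to evaluate the continuants.  Up to a monomial they satisfy the
    recurrence that the double sums of Gaussian binomials obey by two
    applications of Pascal's rule ([closed_sum_rec], [continuant_closed_sum]). *)

(** * The closed form of the continuants *)

(** Recursive rather than a quotient of products: Pascal's rule holds by
    computation and the value is 0 for k > m, whatever p is. *)
Fixpoint qbin (R : comNzRingType) (p : R) (m k : nat) : R :=
  match m, k with
  | _, 0 => 1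
  | 0, _.+1 => 0
  | m'.+1, k'.+1 => qbin p m' k' + p ^+ k'.+1 * qbin p m' k'.+1
  end.

Definition qfact (R : comNzRingType) (p : R) (m : nat) : R :=
  \prod_(i < m) (1 - p ^+ i.+1).

Section QBinomial.

Variables (F : fieldType) (p : F).
Hypothesis p_aperiodic : forall i, 1 - p ^+ i.+1 != 0.

Lemma qbin0 m : qbin p m 0 = 1.
Proof. by case: m. Qed.

Lemma qbinSS m k : qbin p m.+1 k.+1 = qbin p m k + p ^+ k.+1 * qbin p m k.+1.
Proof. by []. Qed.

Lemma qbin_small m k : (m < k)%N -> qbin p m k = 0.
Proof.
elim: m k => [|m IHm] [|k] //= lt_mk.
by rewrite !IHm ?mulr0 ?addr0 //; lia.
Qed.

Lemma qbinn m : qbin p m m = 1.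
Proof. by elim: m => //= m ->; rewrite qbin_small ?mulr0 ?addr0. Qed.

Lemma qfactS m : qfact p m.+1 = qfact p m * (1 - p ^+ m.+1).
Proof. by rewrite /qfact big_ord_recr. Qed.

Lemma qfact_neq0 m : qfact p m != 0.
Proof. by apply/prodf_neq0 => i _; apply: p_aperiodic. Qed.

(** By Pascal's rule and induction both summands are multiples of the same
    factorial, with factors adding up to
    1 - p^(k+1) + p^(k+1) (1 - p^(m+1)) = 1 - p^(m+k+2). *)
Lemma qbin_qfact m k : qbin p (m + k) k * qfact p m * qfact p k = qfact p (m + k).
Proof.
have [s] : exists s, (m + k)%N = s by exists (m + k)%N.
elim: s m k => [|s IHs] [|m] [|k] // eq_s;
  rewrite ?add0n ?addn0 ?qbin0 ?qbinn ?mul1r; try by rewrite /qfact big_ord0 ?mulr1 ?mul1r.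
move: eq_s; rewrite addSn addnS => -[eq_s].
have IHk : qbin p (m + k).+1 k * qfact p m.+1 * qfact p k = qfact p (m + k).+1.
  by rewrite -addSn IHs //; lia.
have IHm : qbin p (m + k).+1 k.+1 * qfact p m * qfact p k.+1 = qfact p (m + k).+1.
  by rewrite -addnS IHs //; lia.
rewrite qbinSS.
transitivity ((1 - p ^+ k.+1) * qfact p (m + k).+1
    + p ^+ k.+1 * (1 - p ^+ m.+1) * qfact p (m + k).+1).
  by rewrite -{1}IHk -IHm !qfactS; ring.
rewrite (qfactS (m + k).+1); have -> : p ^+ (m + k).+2 = p ^+ k.+1 * p ^+ m.+1.
  by rewrite -exprD; congr (_ ^+ _); lia.
by ring.
Qed.

Lemma gauss_binomE m k :
  gauss_binom p (m + k) k = qfact p (m + k) / (qfact p m * qfact p k).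
Proof.
rewrite /gauss_binom big_add1 /= big_mkord.
rewrite (eq_bigr (fun i : 'I_k => (1 - p ^+ (m + i.+1)) / (1 - p ^+ i.+1))); last first.
  by move=> i _; rewrite PoszD addrK -PoszD.
elim: k => [|k IHk].
  by rewrite big_ord0 addn0 /qfact big_ord0 mulr1 divff ?qfact_neq0.
rewrite big_ord_recr /= IHk addnS !qfactS; field.
by rewrite !qfact_neq0 p_aperiodic.
Qed.

Lemma gauss_binom_qbin m k : gauss_binom p (m + k) k = qbin p (m + k) k.
Proof.
rewrite gauss_binomE -(qbin_qfact m k); field.
by rewrite !qfact_neq0.
Qed.

(** The binomial of k + a and a can thus be given the lower index k, and a single
    form of Pascal's rule serves for both factors in the double sums. *)
Lemma gauss_binom_qbinC m k : gauss_binom p (m + k) k = qbin p (m + k) m.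
Proof.
rewrite gauss_binomE addnC -(qbin_qfact k m); field.
by rewrite !qfact_neq0.
Qed.

End QBinomial.

(** The denominator of the continued fraction of Motzkin paths with heights in
    [h, h + k - 1], a vertex of height j weighing q^j, a level step x + y, and an
    up step together with the matching down step x y. *)
Fixpoint continuant (R : comNzRingType) (x y q : R) (k h : nat) : R :=
  match k with
  | 0 => 1
  | k'.+1 => (1 - q ^+ h * (x + y)) * continuant x y q k' h.+1
             - (if k' is k''.+1 then
                  x * y * q ^+ (2 * h).+1 * continuant x y q k'' h.+2
                else 0)
  end.

Lemma rmorph_continuant (R S : comNzRingType) (g : {rmorphism R -> S})
    (x y q : R) k h :
  g (continuant x y q k h) = continuant (g x) (g y) (g q) k h.
Proof.
have [s] := ubnP k; elim: s k h => // s IHs [|k] h lt_k /=; first exact: rmorph1.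
rewrite rmorphB rmorphM rmorphB rmorph1 rmorphM rmorphXn rmorphD IHs //.
case: k lt_k => [|k] lt_k; first by rewrite rmorph0.
by rewrite !rmorphM rmorphXn IHs //; lia.
Qed.

Section ClosedForm.

Variables (F : fieldType) (x y q : F).
Hypotheses (y_neq0 : y != 0) (q_neq0 : q != 0).
Hypothesis q_aperiodic : forall i, 1 - q ^+ i.+1 != 0.

Let p := q^-1.

Lemma inv_aperiodic i : 1 - p ^+ i.+1 != 0.
Proof.
rewrite /p exprVn; apply: contra (q_aperiodic i).
by rewrite !subr_eq0 => /eqP/(congr1 (fun z => z^-1)); rewrite invr1 invrK => <-.
Qed.

(** The guard makes the coefficient vanish off the triangle of summation; the
    product alone would not, as N - a is truncated for a > N. *)
Definition closed_coef (N k a : nat) : F :=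
  if (k + a <= N)%N then qbin p (k + a) k * qbin p (N - a) k else 0.

(** The parameter h covers the two sums of the theorem, h = 1 for the
    denominator and h = 2 for the numerator: replacing x, y by x q, y q raises h
    by one, just as it raises all heights by one in a continuant. *)
Definition closed_sum (N h : nat) : F :=
  \sum_(0 <= k < N.+1) \sum_(0 <= a < (N - k).+1)
     (-1) ^+ k * x ^+ a * y ^- (k + a) * q ^- ('C(k, 2) + h * k)
     * gauss_binom p (k + a) a * gauss_binom p (N - a) k.

(** The same summand in the variables x / y, which scaling leaves alone, and
    1 / y, which it multiplies by p. *)
Definition closed_term (N h k a : nat) : F :=
  (- y^-1) ^+ k * (x / y) ^+ a * p ^+ ('C(k, 2) + h * k) * closed_coef N k a.

Lemma closed_term_big N h k a : (N < k + a)%N -> closed_term N h k a = 0.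
Proof. by move=> lt_N; rewrite /closed_term /closed_coef leqNgt lt_N mulr0. Qed.

Lemma closed_sumE N h M : (N < M)%N ->
  closed_sum N h = \sum_(k < M) \sum_(a < M) closed_term N h k a.
Proof.
move=> lt_NM; rewrite /closed_sum (big_nat_widen _ _ _ _ _ lt_NM) big_mkord big_mkcond /=.
apply: eq_bigr => k _; case: ifP => [lt_kN|/negbT ge_kN]; last first.
  by rewrite big1 // => a _; rewrite closed_term_big //; lia.
rewrite (@big_nat_widen _ _ _ _ _ M); last by lia.
rewrite big_mkord big_mkcond /=; apply: eq_bigr => a _.
case: ifP => [lt_a|/negbT ge_a]; last by rewrite closed_term_big //; lia.
have p_ap := inv_aperiodic.
rewrite gauss_binom_qbinC //.
have -> : gauss_binom p (N - a) k = qbin p (N - a) k.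
  have -> : (N - a = N - a - k + k)%N by lia.
  exact: gauss_binom_qbin.
rewrite /closed_term /closed_coef; have -> : (k + a <= N)%N by lia.
rewrite exprMn -(exprVn q) -/p [(- y^-1) ^+ k]exprNn !exprVn exprD invfM.
by ring.
Qed.

Lemma closed_term0S N h a :
  closed_term N.+2 h 0 a.+1 =
    closed_term N.+1 h.+1 0 a.+1
    + (x / y) * (closed_term N.+1 h.+1 0 a - closed_term N h.+2 0 a).
Proof.
rewrite /closed_term /closed_coef !add0n !qbin0 !muln0 !expr0 exprS !ltnS.
by case: leqP => [_|]; case: leqP => // *; first [by ring | lia].
Qed.

Lemma closed_term00 N h : closed_term N h 0 0 = 1.
Proof. by rewrite /closed_term /closed_coef /= !qbin0 !muln0 !expr0 !mulr1. Qed.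

Lemma closed_termS0 N h k :
  closed_term N.+2 h k.+1 0 =
    closed_term N.+1 h.+1 k.+1 0 - y^-1 * p ^+ h * closed_term N.+1 h.+1 k 0.
Proof.
rewrite /closed_term /closed_coef !addn0 !subn0 !expr0 !qbinn !exprS.
have -> : p ^+ ('C(k.+1, 2) + h.+1 * k.+1) = p ^+ ('C(k.+1, 2) + h * k.+1) * p ^+ k.+1.
  by rewrite -exprD; congr (_ ^+ _); lia.
have -> : p ^+ ('C(k.+1, 2) + h * k.+1) = p ^+ h * p ^+ ('C(k, 2) + h.+1 * k).
  by rewrite -exprD; congr (_ ^+ _); rewrite binS bin1; lia.
rewrite ltnS.
have [le_k|gt_k] := leqP k N.+1; last by case: ifP => ?; [lia|ring].
rewrite (qbinSS _ N.+1); case: ifP => [_|/negbT gt_k]; first by ring.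
by rewrite (@qbin_small _ _ N.+1 k.+1); [ring|lia].
Qed.

(** Write the two Gaussian binomials as B + p^(k+1) C and X + p^(k+1) Y by
    Pascal's rule.  The four products regroup as
    p^(k+1) (B + p^(k+1) C) Y + p^(k+1) C (X + p^(k+1) Y) + B X - p^(2k+2) C Y,
    which are the four terms on the right.  On the edge of the triangle of
    summation Y is 0, in agreement with the guards. *)
Lemma closed_termSS N h k a :
  closed_term N.+2 h k.+1 a.+1 =
    closed_term N.+1 h.+1 k.+1 a.+1
    + (x / y) * (closed_term N.+1 h.+1 k.+1 a - closed_term N h.+2 k.+1 a)
    - y^-1 * p ^+ h * closed_term N.+1 h.+1 k a.+1.
Proof.
rewrite /closed_term /closed_coef.
have -> : p ^+ ('C(k.+1, 2) + h.+2 * k.+1)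
     = p ^+ ('C(k.+1, 2) + h * k.+1) * p ^+ k.+1 * p ^+ k.+1.
  by rewrite -!exprD; congr (_ ^+ _); lia.
have -> : p ^+ ('C(k.+1, 2) + h.+1 * k.+1) = p ^+ ('C(k.+1, 2) + h * k.+1) * p ^+ k.+1.
  by rewrite -exprD; congr (_ ^+ _); lia.
have -> : p ^+ ('C(k.+1, 2) + h * k.+1) = p ^+ h * p ^+ ('C(k, 2) + h.+1 * k).
  by rewrite -exprD; congr (_ ^+ _); rewrite binS bin1; lia.
rewrite !(exprS _ a) (exprS (- y^-1)).
have [le_ka|gt_ka] := leqP (k.+1 + a.+1) N.+2; last first.
  by rewrite !(ifF _ _ (_ : (_ <= _)%N = false)); first [ring | lia].
have -> : (k.+1 + a <= N.+1)%N by lia.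
have -> : (k + a.+1 <= N.+1)%N by lia.
have -> : qbin p (k.+1 + a.+1) k.+1 =
   qbin p (k + a.+1) k + p ^+ k.+1 * qbin p (k.+1 + a) k.+1.
  by rewrite !addSn !addnS qbinSS.
have -> : (N.+1 - a = (N - a).+1)%N by lia.
have -> : (N.+2 - a.+1 = (N - a).+1)%N by lia.
have -> : (N.+1 - a.+1 = N - a)%N by lia.
rewrite (qbinSS _ (N - a)).
have [le_kaN|gt_kaN] := leqP (k.+1 + a.+1) N.+1.
  have -> : (k.+1 + a <= N)%N by lia.
  by ring.
have -> : (k.+1 + a <= N)%N = false by lia.
by rewrite (@qbin_small _ _ (N - a) k.+1); [ring|lia].
Qed.

(** Summation of the termwise recurrences; multiplication by x / y or 1 / y moves
    an index by one, which costs nothing as the terms at the far border vanish. *)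
Lemma closed_sum_rec N h :
  closed_sum N.+2 h = (1 + x / y - y^-1 * p ^+ h) * closed_sum N.+1 h.+1
                - x / y * closed_sum N h.+2.
Proof.
rewrite !(@closed_sumE _ _ N.+3) //; last by lia.
pose shift g i : F := if i is j.+1 then g j else 0.
have sum_shift g : g N.+2 = 0 ->
    \sum_(i < N.+3) g i = \sum_(i < N.+3) shift g i.
  by move=> g0; rewrite big_ord_recr [RHS]big_ord_recl /= g0 addr0 add0r.
have col_shift N' h' : (N' < N.+2)%N ->
    \sum_(k < N.+3) \sum_(a < N.+3) closed_term N' h' k a =
    \sum_(k < N.+3) \sum_(a < N.+3) shift (closed_term N' h' k) a.
  move=> lt_N'; apply: eq_bigr => k _; apply: (sum_shift (closed_term N' h' k)).
  by rewrite closed_term_big //; lia.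
have row_shift : \sum_(k < N.+3) \sum_(a < N.+3) closed_term N.+1 h.+1 k a =
    \sum_(k < N.+3) \sum_(a < N.+3) shift (fun k' => closed_term N.+1 h.+1 k' a) k.
  rewrite exchange_big [RHS]exchange_big; apply: eq_bigr => a _.
  apply: (sum_shift (fun k' => closed_term N.+1 h.+1 k' a)).
  by rewrite closed_term_big //; lia.
(* Shift the index wherever a factor x / y or 1 / y has to be absorbed. *)
rewrite mulrBl mulrDl mul1r (col_shift N) // [in _ * p ^+ h * _]row_shift.
rewrite [X in _ + x / y * X]col_shift //.
rewrite !mulr_sumr -!sumrN -!big_split /=.
apply: eq_bigr => k _; rewrite !mulr_sumr -!sumrN -!big_split /=.
apply: eq_bigr => a _; case: (nat_of_ord k) (nat_of_ord a) => [|i] [|j] /=.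
- by rewrite !closed_term00; ring.
- by rewrite closed_term0S; ring.
- by rewrite closed_termS0; ring.
- by rewrite closed_termSS; ring.
Qed.

(** After division by the monomial, the recurrence of the continuants is
    [closed_sum_rec], with the same two initial values. *)
Lemma continuant_closed_sum N h :
  continuant x y q N h = (- y) ^+ N * q ^+ (h * N + 'C(N, 2)) * closed_sum N h.
Proof.
have closed_sum0 h' : closed_sum 0 h' = 1.
  by rewrite (@closed_sumE _ _ 1) // !big_ord1 closed_term00.
have [s] := ubnP N; elim: s N h => // s IHs [|[|N]] h lt_N.
- by rewrite closed_sum0 muln0 !expr0 !mulr1.
- rewrite (@closed_sumE _ _ 2) // !big_ord_recl !big_ord0 /= !addr0.
  rewrite closed_term00 [closed_term 1 h 1 1]closed_term_big // addr0.
  rewrite /closed_term /closed_coef /= subr0.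
  rewrite !muln0 !muln1 !addn0 !expr0 !expr1 !mulr0 !mulr1 !addr0 mul1r.
  rewrite /p exprVn; field.
  by rewrite expf_neq0.
rewrite closed_sum_rec [LHS]/= -/(continuant x y q N.+1 h.+1) !IHs //; last by lia.
have -> : q ^+ (h * N.+2 + 'C(N.+2, 2)) = q ^+ h * q ^+ (h.+1 * N.+1 + 'C(N.+1, 2)).
  by rewrite -exprD; congr (_ ^+ _); rewrite (binS N.+1) bin1; lia.
have -> : q ^+ (h.+1 * N.+1 + 'C(N.+1, 2)) = q ^+ h.+1 * q ^+ (h.+2 * N + 'C(N, 2)).
  by rewrite -exprD; congr (_ ^+ _); rewrite (binS N) bin1; lia.
have -> : q ^+ (2 * h).+1 = q * q ^+ h * q ^+ h.
  by rewrite -exprS -exprD; congr (_ ^+ _); lia.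
rewrite /p exprVn !exprS; field.
by rewrite y_neq0 expf_neq0.
Qed.

Lemma continuant_ratio n : continuant x y q n.+1 1 != 0 ->
  x * y * q * continuant x y q n 2 / continuant x y q n.+1 1 =
  - ((x * closed_sum n 2) / closed_sum n.+1 1).
Proof.
rewrite !continuant_closed_sum => /[!mulf_eq0] /[!negb_or] /andP[_ closed_sum_neq0].
have -> : q ^+ (1 * n.+1 + 'C(n.+1, 2)) = q * q ^+ (2 * n + 'C(n, 2)).
  by rewrite -exprS; congr (_ ^+ _); rewrite (binS n) bin1; lia.
have Y_neq0 : (- y) ^+ n != 0 by rewrite expf_neq0 // oppr_eq0.
have Q_neq0 : q ^+ (2 * n + 'C(n, 2)) != 0 by rewrite expf_neq0.
rewrite (exprS (- y)).
move: closed_sum_neq0 Y_neq0 Q_neq0; move: (closed_sum _ _) (closed_sum _ _) (_ ^+ _) (_ ^+ _).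
move=> num den Y Q; move=> den_neq0 Y_neq0 Q_neq0; field.
by rewrite den_neq0 Y_neq0 Q_neq0 q_neq0 oppr_eq0 y_neq0.
Qed.

End ClosedForm.

(** * Power series modulo high degree *)

Section HighDegree.

Variables (n : nat) (R : comNzRingType).
Implicit Types (p r : {mpoly R[n]}) (m k : 'X_{1..n}).

Lemma mcoeffMX_le p k m :
  (p * 'X_[k])@_m = if (k <= m)%MM then p@_(m - k) else 0.
Proof.
case: ifP => [le_km|nle_km]; first by rewrite -{1}(submK le_km) addmC mcoeffMX.
apply/eqP; rewrite mcoeff_eq0 (perm_mem (msuppMX p k)).
by apply/mapP => -[m' _ eq_m]; rewrite eq_m lem_addr in nle_km.
Qed.

(** An ideal: a congruence modulo it is an identity of power series up to
    degree d. *)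
Definition high_degree (d : nat) p : Prop := forall m, (mdeg m < d)%N -> p@_m = 0.

Lemma high_degreeD d p r :
  high_degree d p -> high_degree d r -> high_degree d (p + r).
Proof. by move=> hp hr m lt_m; rewrite mcoeffD hp // hr // addr0. Qed.

Lemma high_degreeN d p : high_degree d p -> high_degree d (- p).
Proof. by move=> hp m lt_m; rewrite mcoeffN hp // oppr0. Qed.

Lemma high_degreeMl d p r : high_degree d r -> high_degree d (p * r).
Proof.
move=> hr m lt_m; rewrite mcoeffM big1 // => k /eqP eq_m.
rewrite hr ?mulr0 // (leq_ltn_trans _ lt_m) //.
by rewrite [X in (_ <= mdeg X)%N]eq_m mdegD leq_addl.
Qed.

Lemma high_degreeXM d i p : high_degree d p -> high_degree d.+1 ('X_i * p).
Proof.
move=> hp m lt_m; rewrite mulrC mcoeffMX_le; case: ifP => // le_im.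
by apply: hp; move: lt_m; rewrite -{1}(submK le_im) mdegD mdeg1 addn1.
Qed.

End HighDegree.

(** A coefficient of the product involves finitely many coefficients of the
    series, so the series may be replaced by any polynomial that has these. *)
Lemma fps_mul_mpolyE (Q g : {mpoly int[3]}) (f : fps) m :
  (forall k, (k <= m)%MM -> f k = g@_k) -> fps_mul_mpoly Q f m = (Q * g)@_m.
Proof.
move=> eq_fg; rewrite /fps_mul_mpoly [in RHS](mpolyE Q) mulr_suml raddf_sum /=.
rewrite big_mkcond; apply: eq_bigr => k _.
rewrite -scalerAl mcoeffZ mulrC mulrC [_ * g]mulrC mcoeffMX_le.
by case: ifP => [le_km|]; rewrite ?mulr0 // eq_fg // lem_subr.
Qed.

(** A step is a pair of bits, for the lower and the upper path; true is east. *)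
Definition steps : seq (bool * bool) :=
  [:: (true, false); (true, true); (false, false); (false, true)].

Definition next_height (h : nat) (s : bool * bool) : nat := (h + s.1 - s.2)%N.

(** The bound L on the length keeps the list finite; the series F_h is the limit
    of its generating polynomials as L grows. *)
Fixpoint walks (N h L : nat) : seq (seq (bool * bool)) :=
  if h == 0%N then [:: [::]] else
  if (N < h)%N then [::] else
  if L is L'.+1 then [seq s :: w | s <- steps, w <- walks N (next_height h s) L']
  else [::].

Lemma walksS N h L : (h < N)%N -> walks N h.+1 L.+1 =
  [seq s :: w | s <- steps, w <- walks N (next_height h.+1 s) L].
Proof. by rewrite ltnNge => /negPf lt_hN; rewrite {1}/walks -/walks ltnS lt_hN. Qed.

(** A step is charged with the height of the vertex that it leaves, so the
    final vertex, of height 0, needs no special treatment. *)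
Definition step_mon (h : nat) (s : bool * bool) : 'X_{1..3} :=
  (U_((if s.1 then 0 else 1)%R) + U_(2%R) *+ h)%MM.

Fixpoint walk_mon (h : nat) (w : seq (bool * bool)) : 'X_{1..3} :=
  if w is s :: w' then (step_mon h s + walk_mon (next_height h s) w')%MM else 0%MM.

Section WalkSeries.

Variable N : nat.

Definition walk_poly (h L : nat) : {mpoly int[3]} :=
  \sum_(w <- walks N h L) 'X_[walk_mon h w].

Let x : {mpoly int[3]} := 'X_0.
Let y : {mpoly int[3]} := 'X_1.
Let q : {mpoly int[3]} := 'X_2.

Lemma walk_poly0 L : walk_poly 0 L = 1.
Proof. by rewrite /walk_poly; case: L => [|L]; rewrite big_seq1 mpolyX0. Qed.

Lemma walk_poly_gt h L : (N < h)%N -> walk_poly h L = 0.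
Proof.
case: h => // h lt_Nh; rewrite /walk_poly.
by case: L => [|L] /=; rewrite lt_Nh big_nil.
Qed.

Lemma walk_polyS h L : (h < N)%N ->
  walk_poly h.+1 L.+1 =
    q ^+ h.+1 * (x * walk_poly h.+2 L + (x + y) * walk_poly h.+1 L
                 + y * walk_poly h L).
Proof.
move=> lt_hN; rewrite {1}/walk_poly walksS // big_allpairs_dep.
have step_poly (s : bool * bool) :
    \sum_(w <- walks N (next_height h.+1 s) L) 'X_[walk_mon h.+1 (s :: w)]
    = q ^+ h.+1 * ((if s.1 then x else y) * walk_poly (next_height h.+1 s) L).
  rewrite /walk_poly mulr_sumr mulr_sumr; apply: eq_bigr => w _ /=.
  rewrite !mpolyXD -mpolyXn mulrA; congr (_ * _); rewrite mulrC.
  by case: s.1.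
rewrite (eq_bigr _ (fun s _ => step_poly s)) !big_cons big_nil /=.
rewrite /next_height !(addn0, addn1, subn0, subn1) /=; ring.
Qed.

(** A walk of length L + 1 has degree greater than L, as each step contributes
    an x or a y. *)
Lemma walk_poly_step h L : high_degree L (walk_poly h L.+1 - walk_poly h L).
Proof.
elim: L h => [|L IHL] h; first by move=> m.
case: h => [|h]; first by rewrite !walk_poly0 subrr => m _; rewrite mcoeff0.
have [lt_hN|le_Nh] := ltnP h N; last first.
  by rewrite !walk_poly_gt // subrr => m _; rewrite mcoeff0.
rewrite [X in X - _]walk_polyS // [X in _ - X]walk_polyS //.
set a := walk_poly h.+2; set b := walk_poly h.+1; set c := walk_poly h.
rewrite (_ : _ - _ = q ^+ h.+1 * (x * (a L.+1 - a L) +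
    (x * (b L.+1 - b L) + (y * (b L.+1 - b L) + y * (c L.+1 - c L))))); last by ring.
have XM (i : 'I_3) h' := high_degreeXM i (IHL h').
apply: high_degreeMl; apply: (high_degreeD (XM 0 _)).
by apply: (high_degreeD (XM 0 _)); apply: (high_degreeD (XM 1 _) (XM 1 _)).
Qed.

Lemma walk_poly_stable h L L' : (L <= L')%N ->
  high_degree L (walk_poly h L' - walk_poly h L).
Proof.
move=> /subnK <-; elim: (_ - _)%N => [|k IHk].
  by rewrite subrr => m _; rewrite mcoeff0.
rewrite addSn -(subrK (walk_poly h (k + L)) (walk_poly _ _)) -addrA.
apply: high_degreeD => // m lt_m; apply: walk_poly_step.
exact: leq_trans lt_m (leq_addl _ _).
Qed.

(** Downward induction on the height, eliminating the unknown of greater height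
    from the equation of each vertex.  At the top that unknown is 0. *)
Lemma continuant_walk_poly k h L : (k + h.+1 = N)%N ->
  high_degree L (continuant x y q k.+1 h.+1 * walk_poly h.+1 L
    - y * q ^+ h.+1 * continuant x y q k h.+2 * walk_poly h L).
Proof.
have step_eq h' : (h' < N)%N -> high_degree L
    (walk_poly h'.+1 L - q ^+ h'.+1 * (x * walk_poly h'.+2 L
        + (x + y) * walk_poly h'.+1 L + y * walk_poly h' L)).
  move=> lt_h'N; rewrite -walk_polyS // -opprB.
  exact/high_degreeN/walk_poly_step.
elim: k h => [|k IHk] h eq_N.
  have := step_eq h; rewrite (@walk_poly_gt h.+2) ?mulr0; last by lia.
  set r := (X in high_degree L X) => step_h.
  by rewrite (_ : _ - _ = r); [apply: step_h; lia | rewrite /r /=; ring].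
have IH := IHk h.+1 (etrans _ eq_N); have step_h := step_eq h.
set r := (X in high_degree L X) in step_h.
set r' := (X in high_degree L X) in IH.
rewrite (_ : _ - _ = continuant x y q k.+1 h.+2 * r + q ^+ h.+1 * x * r').
  apply: high_degreeD; apply: high_degreeMl; first by apply: step_h; lia.
  by apply: IH; lia.
rewrite /r /r' [continuant x y q k.+2 h.+1]/= -/(continuant x y q k.+1 h.+2).
have -> : q ^+ (2 * h.+1).+1 = q ^+ h.+1 * q ^+ h.+2.
  by rewrite -exprD; congr (_ ^+ _); lia.
by ring.
Qed.

End WalkSeries.

(** The constant coefficient is 1. *)
Lemma continuant_neq0 k h :
  continuant 'X_0 'X_1 'X_2 k h.+1 != 0 :> {mpoly int[3]}.
Proof.
suff coef0 : (continuant 'X_0 'X_1 'X_2 k h.+1 : {mpoly int[3]})@_0 = 1.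
  by apply/eqP => eq0; move: coef0; rewrite eq0 mcoeff0.
have [s] := ubnP k; elim: s k h => // s IHs [|k] h lt_k; first by rewrite mcoeff1 eqxx.
pose x : {mpoly int[3]} := 'X_0; pose y : {mpoly int[3]} := 'X_1.
pose q : {mpoly int[3]} := 'X_2; pose K := continuant x y q.
have -> : continuant 'X_0 'X_1 'X_2 k.+1 h.+1 = K k h.+2 +
    q * (- q ^+ h * (x + y) * K k h.+2
         - (if k is k'.+1 then x * y * q ^+ (2 * h.+1) * K k' h.+3 else 0)).
  by rewrite /K /x /y /q /=; case: (k) => [|k']; rewrite !exprS; ring.
rewrite mcoeffD IHs // (_ : (_ * _)@_0 = 0) ?addr0 //.
by apply: (@high_degreeXM _ _ 0 2); rewrite ?mdeg0.
Qed.

(** The factor x is the weight of the first step of a polyomino, which leaves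
    height 0 for height 1. *)
Definition walk_series (N : nat) : fps :=
  fun m => ('X_0 * walk_poly N 1 (mdeg m).+1)@_m.

Lemma walk_series_rational n m :
  fps_mul_mpoly (continuant 'X_0 'X_1 'X_2 n.+1 1) (walk_series n.+1) m
  = ('X_0 * 'X_1 * 'X_2 * continuant 'X_0 'X_1 'X_2 n 2)@_m.
Proof.
set L := (mdeg m).+1.
rewrite (@fps_mul_mpolyE _ ('X_0 * walk_poly n.+1 1 L)); last first.
  move=> k le_km; have le_kL : ((mdeg k).+1 <= L)%N.
    by rewrite ltnS -(submK le_km) mdegD leq_addl.
  apply/esym/eqP; rewrite -subr_eq0 -mcoeffB -mulrBr; apply/eqP.
  apply: (@high_degreeMl _ _ (mdeg k).+1); last exact: ltnSn.
  exact: walk_poly_stable.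
apply/eqP; rewrite -subr_eq0 -mcoeffB; apply/eqP.
have := @continuant_walk_poly n.+1 n 0 L (addn1 n).
rewrite walk_poly0 => /(high_degreeMl 'X_0)/(_ m (ltnSn _)) <-.
by congr (_@__); ring.
Qed.

(** * Squares between two words *)

Definition easts (l : seq bool) (d : nat) : nat := count id (take d l).

Lemma easts0 l : easts l 0 = 0%N.
Proof. by rewrite /easts take0. Qed.

Lemma easts_cons b l d : easts (b :: l) d.+1 = (b + easts l d)%N.
Proof. by []. Qed.

Lemma eastsS l d : easts l d.+1 = (easts l d + nth false l d)%N.
Proof.
elim: l d => [|b l IHl] [|d] //=; rewrite ?easts_cons ?easts0 ?addn0 //.
by rewrite IHl addnA.
Qed.

Lemma easts_oversize l d : (size l <= d)%N -> easts l d = easts l (size l).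
Proof. by move=> le_ld; rewrite /easts take_size take_oversize. Qed.

Lemma easts_inj l l' : size l = size l' -> easts l =1 easts l' -> l = l'.
Proof.
move=> eq_size eq_l; apply: (@eq_from_nth _ false) => // i _.
have := eastsS l i; rewrite !eq_l eastsS => /addnI.
by case: nth; case: nth.
Qed.

Lemma leq_easts l d e : (d <= e)%N -> (easts l d <= easts l e <= easts l d + (e - d))%N.
Proof.
move=> /subnK <-; elim: (_ - _)%N => [|k IHk]; first by rewrite add0n subnn addn0 leqnn.
by rewrite addSn eastsS; case: nth; lia.
Qed.

Lemma easts_le l d : (easts l d <= d)%N.
Proof. by have := leq_easts l (leq0n d); rewrite easts0; lia. Qed.

(** The time of the east step that crosses the vertical strip [c, c + 1]. *)
Lemma easts_first l c d : (c < easts l d)%N ->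
  exists e, [/\ (e < d)%N, (e < size l)%N, easts l e = c & easts l e.+1 = c.+1].
Proof.
elim: d => [|d IHd]; first by rewrite easts0.
have [lt_cd _|le_dc lt_c] := ltnP c (easts l d).
  by have [e [? ? ? ?]] := IHd lt_cd; exists e; split => //; lia.
exists d; move: (lt_c); rewrite eastsS => lt_c'.
have [lt_d|/(nth_default false) nth0] := ltnP d (size l); last by rewrite nth0 in lt_c'; lia.
by split => //; case: nth lt_c' => /=; lia.
Qed.

Definition move (z : nat * nat) (b : bool) : nat * nat :=
  if b then (z.1.+1, z.2) else (z.1, z.2.+1).

Definition trace (l : seq bool) : seq (nat * nat) := scanl move (0, 0)%N l.

Lemma path_trace z l : path ne_step z (scanl move z l).
Proof.
elim: l z => //= b l IHl z; rewrite IHl andbT /ne_step /move.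
by case: b; rewrite eqxx ?orbT.
Qed.

Lemma trace_path z p : path ne_step z p -> exists l, p = scanl move z l.
Proof.
elim: p z => [|u p IHp] z /=; first by exists [::].
case/andP=> step_zu /IHp[l ->].
case/orP: step_zu => /eqP ->; first by exists (true :: l).
by exists (false :: l).
Qed.

Lemma last_trace z l :
  last z (scanl move z l) = (z.1 + count id l, z.2 + (size l - count id l))%N.
Proof.
elim: l z => [|b l IHl] z /=; first by rewrite !addn0; case: z.
rewrite IHl; have := count_size id l.
by case: b; rewrite /move /= => ?; congr pair; lia.
Qed.

Lemma mem_scanl_move u l z :
  reflect (exists2 d, (d <= size l)%N & z = (u.1 + easts l d, u.2 + (d - easts l d))%N)
          (z \in u :: scanl move u l).
Proof.
elim: l u z => [|b l IHl] u z /=.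
  rewrite inE; apply: (iffP eqP) => [->|[d le_d0 ->]].
    by exists 0%N; rewrite ?easts0 ?subn0 ?addn0 //; case: u.
  by move: le_d0; rewrite leqn0 => /eqP ->; rewrite easts0 subn0 !addn0; case: (u).
rewrite inE; apply: (iffP orP) => [[/eqP ->|/IHl[d le_d ->]]|[[|d] le_d ->]].
- by exists 0%N; rewrite ?easts0 ?subn0 ?addn0 //; case: u.
- exists d.+1 => //; rewrite easts_cons; have := easts_le l d.
  by case: b; rewrite /move /= => ?; congr pair; lia.
- by left; rewrite easts0 subn0 !addn0; case: (u).
- right; apply/IHl; exists d => //; rewrite easts_cons; have := easts_le l d.
  by case: b; rewrite /move /= => ?; congr pair; lia.
Qed.

(** After d steps the path is on the line x + y = d, so the time of a visit can
    be read off from the visited point. *)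
Lemma mem_visited_trace l z :
  (z \in visited (trace l)) = (z.1 + z.2 <= size l)%N && (z.1 == easts l (z.1 + z.2)).
Proof.
apply/mem_scanl_move/andP => [[d le_d ->]|[le_z /eqP eq_z]] /=.
  by have := easts_le l d => ?; rewrite !add0n subnKC.
by exists (z.1 + z.2)%N => //; case: z le_z eq_z => i j /= _ <-; congr pair; lia.
Qed.

(** The path crosses the column of z once, by an east step from height h at time
    z.1 + h; so h <= z.2 means that the step is over at time z.1 + z.2 + 1. *)
Lemma passes_below_trace l z :
  passes_below (trace l) z = (z.1 < easts l (z.1 + z.2).+1)%N.
Proof.
apply/hasP/idP => [[h]|/easts_first[e [lt_e lt_el eq_e eq_e1]]].
  rewrite mem_iota !mem_visited_trace /= add0n => le_h.
  case/andP=> _ /andP[_ /eqP eq_h].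
  have /(leq_easts l) : (z.1.+1 + h <= (z.1 + z.2).+1)%N by lia.
  by rewrite -eq_h; lia.
have := easts_le l e => le_e; exists (e - z.1)%N; first by rewrite mem_iota; lia.
by rewrite !mem_visited_trace /= addSn subnKC; lia.
Qed.

Definition lower (w : seq (bool * bool)) (d : nat) : nat := easts (unzip1 w) d.
Definition upper (w : seq (bool * bool)) (d : nat) : nat := easts (unzip2 w) d.

Lemma lower0 w : lower w 0 = 0%N. Proof. exact: easts0. Qed.
Lemma upper0 w : upper w 0 = 0%N. Proof. exact: easts0. Qed.

Lemma lower_cons s w d : lower (s :: w) d.+1 = (s.1 + lower w d)%N.
Proof. by []. Qed.

Lemma upper_cons s w d : upper (s :: w) d.+1 = (s.2 + upper w d)%N.
Proof. by []. Qed.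

Lemma lower_le w d : (lower w d <= d)%N.
Proof. exact: easts_le. Qed.

Lemma lower_oversize w d : (size w <= d)%N -> lower w d = lower w (size w).
Proof. by move=> le_wd; rewrite /lower easts_oversize ?size_map. Qed.

Lemma upper_oversize w d : (size w <= d)%N -> upper w d = upper w (size w).
Proof. by move=> le_wd; rewrite /upper easts_oversize ?size_map. Qed.

(** Length one has to be excluded because of the words made of a single level
    step, whose two paths coincide. *)
Definition polyomino_word (N : nat) (w : seq (bool * bool)) : Prop :=
  [/\ (1 < size w)%N,
      forall d, (0 < d < size w)%N -> (upper w d < lower w d <= upper w d + N)%N
    & lower w (size w) = upper w (size w)].

(** Square (i, d - i) lies on the diagonal of time d + 1. *)
Definition squares (w : seq (bool * bool)) : seq (nat * nat) :=
  [seq (i, d - i)%N | d <- iota 0 (size w),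
     i <- iota (upper w d.+1) (lower w d.+1 - upper w d.+1)].

Definition enclosed (w : seq (bool * bool)) : {fset nat * nat} :=
  [fset z in squares w]%fset.

Lemma squares_uniq w : uniq (squares w).
Proof.
apply: allpairs_uniq_dep => [|d _|]; try exact: iota_uniq.
move=> _ _ /allpairsPdep[d [i [_ Hi ->]]] /allpairsPdep[d' [i' [_ Hi' ->]]] /= [].
move: Hi Hi'; rewrite !mem_iota => Hi Hi' eq_i eq_d.
have := lower_le w d.+1; have := lower_le w d'.+1.
move=> ? ?.
have -> : d' = d by lia.
by rewrite eq_i.
Qed.

Lemma mem_enclosed w (z : nat * nat) : lower w (size w) = upper w (size w) ->
  (z \in enclosed w) = (upper w (z.1 + z.2).+1 <= z.1 < lower w (z.1 + z.2).+1)%N.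
Proof.
move=> eq_end; rewrite in_fset /=; apply/allpairsPdep/idP => [[d [i [_ Hi ->]]]|Hz].
  have := lower_le w d.+1; move: Hi; rewrite mem_iota /= => Hi ?.
  by rewrite /= subnKC; lia.
exists (z.1 + z.2)%N, z.1; split; last by rewrite addKn; case: (z).
- rewrite mem_iota add0n /= ltnNge; apply/negP => le_wz; move: Hz.
  by rewrite lower_oversize ?upper_oversize; lia.
- by rewrite mem_iota; lia.
Qed.

Lemma card_fset_mem (T : choiceType) (A : {fset T}) (s : seq T) :
  uniq s -> A =i s -> #|` A |%fset = size s.
Proof.
by move=> uniq_s eq_As; apply/perm_size/uniq_perm => //; apply: fset_uniq.
Qed.

Lemma area_enclosed w :
  area (enclosed w) = sumn [seq (lower w d.+1 - upper w d.+1)%N | d <- iota 0 (size w)].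
Proof.
rewrite /area (card_fset_mem (squares_uniq w)) => [|z]; last by rewrite in_fset.
by rewrite size_allpairs_dep; congr sumn; apply: eq_map => d; rewrite size_iota.
Qed.

Lemma card_diagonal w d : lower w (size w) = upper w (size w) ->
  #|` diagonal (enclosed w) d.+1 |%fset = (lower w d.+1 - upper w d.+1)%N.
Proof.
move=> eq_end.
pose s := iota (upper w d.+1) (lower w d.+1 - upper w d.+1).
rewrite (@card_fset_mem _ _ [seq (i, d - i)%N | i <- s]) /s.
- by rewrite size_map size_iota.
- by rewrite map_inj_uniq ?iota_uniq // => i j [].
move: (enclosed w) (fun z => mem_enclosed z eq_end) => A mem_A.
case=> i j; rewrite !inE /= mem_A /=; apply/andP/mapP => [[Hi /eqP eq_d]|[k Hk [-> ->]]].
  have {}eq_d : (i + j)%N = d by lia.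
  exists i; first by rewrite mem_iota; rewrite eq_d in Hi; lia.
  by rewrite -eq_d addKn.
have := lower_le w d.+1; move: Hk; rewrite mem_iota => Hk ?.
by rewrite subnKC; lia.
Qed.

Section WordPolyomino.

Variables (N : nat) (w : seq (bool * bool)).
Hypothesis w_word : polyomino_word N w.

Let lower_upper d : (0 < d < size w)%N -> (upper w d < lower w d <= upper w d + N)%N.
Proof. by case: w_word => _ + _; apply. Qed.

Let eq_end : lower w (size w) = upper w (size w).
Proof. by case: w_word. Qed.

Let size_gt1 : (1 < size w)%N.
Proof. by case: w_word. Qed.

Lemma mem_enclosed_size i j : (i, j) \in enclosed w -> ((i + j).+1 < size w)%N.
Proof.
rewrite mem_enclosed //= => Hij; rewrite ltnNge; apply/negP => le_w.
by move: Hij; rewrite lower_oversize ?upper_oversize; lia.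
Qed.

(** The two paths are apart just before the end and meet there, which forces the
    last step: the lower path goes north and the upper path goes east. *)
Lemma lower_end : lower w (size w).-1 = lower w (size w).
Proof.
have := lower_upper (d := (size w).-1); have := @leq_easts (unzip1 w) _ _ (leq_pred (size w)).
have := @leq_easts (unzip2 w) _ _ (leq_pred (size w)).
by rewrite -!/(lower w _) -!/(upper w _); lia.
Qed.

Lemma upper_end : (upper w (size w).-1).+1 = upper w (size w).
Proof.
have := lower_upper (d := (size w).-1); have := lower_end.
have := @leq_easts (unzip2 w) _ _ (leq_pred (size w)).
by rewrite -!/(upper w _); lia.
Qed.

(** Column i is occupied: at the time when the lower path has just crossed it, the
    upper path is behind, hence has not crossed it. *)
Lemma pcol_enclosed : pcol (enclosed w) = lower w (size w).
Proof.
rewrite /pcol (@card_fset_mem nat _ (iota 0 (lower w (size w)))) ?iota_uniq ?size_iota // => i.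
rewrite mem_iota add0n /=; apply/imfsetP/idP => /= [[[i' j] Hij ->]|lt_i].
  have lt_ij := mem_enclosed_size Hij; move: Hij; rewrite mem_enclosed //=.
  by have := @leq_easts (unzip1 w) _ _ (ltnW lt_ij); rewrite -!/(lower w _); lia.
rewrite -lower_end in lt_i; have [d [lt_d _ eq_d eq_dS]] := easts_first lt_i.
have := lower_upper (d := d.+1); have eqL : lower w d.+1 = i.+1 := eq_dS.
rewrite eqL => lt_up; have le_d := lower_le w d; move: eq_d; rewrite -/(lower w d) => eq_d.
exists (i, d - i)%N => //; rewrite mem_enclosed //= subnKC; last by rewrite -eq_d.
by rewrite eqL; lia.
Qed.

(** Row j is occupied: at the first time when the upper path has risen above it,
    the square of that diagonal adjacent to the upper path lies in row j. *)
Lemma prow_enclosed : prow (enclosed w) = (size w - lower w (size w))%N.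
Proof.
rewrite /prow (@card_fset_mem nat _ (iota 0 (size w - lower w (size w))));
  rewrite ?iota_uniq ?size_iota // => j.
rewrite mem_iota add0n /=; apply/imfsetP/idP => /= [[[i j'] Hij ->]|lt_j].
  have lt_ij := mem_enclosed_size Hij; move: Hij; rewrite mem_enclosed //=.
  have := @leq_easts (unzip2 w) _ _ (ltnW lt_ij); rewrite -!/(upper w _).
  have := @lower_le w (size w); lia.
have ex_d : exists d, (j < d - upper w d)%N.
  by exists (size w).-1; have := upper_end; lia.
case: (ex_minnP ex_d) => [[|d] lt_d min_d]; first by rewrite sub0n in lt_d.
have le_dw : (d.+1 <= (size w).-1)%N by apply: min_d; have := upper_end; lia.
have := min_d d; have := easts_le (unzip2 w) d; have := eastsS (unzip2 w) d.
rewrite -!/(upper w _) => eq_up le_up min'_d.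
have lt_lu := lower_upper (d := d.+1).
exists (upper w d.+1, j) => //.
by rewrite mem_enclosed //= (_ : (upper w d.+1 + j)%N = d); case: nth eq_up => /=; lia.
Qed.

End WordPolyomino.

(** * Polyominoes as words *)

Lemma size_polyomino_word N w w' :
  polyomino_word N w -> polyomino_word N w' -> enclosed w = enclosed w' ->
  size w = size w'.
Proof.
move=> word_w word_w' eq_enc.
have := pcol_enclosed word_w; have := prow_enclosed word_w.
rewrite eq_enc (pcol_enclosed word_w') (prow_enclosed word_w').
by have := lower_le w (size w); have := lower_le w' (size w'); lia.
Qed.

(** The squares of a nonempty diagonal are an interval that determines both paths
    at that time; the length of the word is the number of columns plus rows. *)
Lemma enclosed_inj N w w' :
  polyomino_word N w -> polyomino_word N w' -> enclosed w = enclosed w' -> w = w'.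
Proof.
move=> word_w word_w' eq_enc.
have eq_size := size_polyomino_word word_w word_w' eq_enc.
(* Square (i, (d - i).-1) is the one with abscissa i on the diagonal of time d. *)
have eq_mem i d : (i < d)%N ->
    (upper w d <= i < lower w d)%N = (upper w' d <= i < lower w' d)%N.
  case: word_w word_w' => [_ _ end_w] [_ _ end_w'] lt_id.
  have := mem_enclosed (i, (d - i).-1) end_w; rewrite eq_enc mem_enclosed //=.
  by have -> : (i + (d - i).-1).+1 = d by lia.
have eq_col : lower w (size w) = lower w' (size w').
  by rewrite -(pcol_enclosed word_w) eq_enc (pcol_enclosed word_w').
have eq_heights d : lower w d = lower w' d /\ upper w d = upper w' d.
  case: word_w word_w' => [_ hw end_w] [_ hw' end_w'].
  have [le_wd|lt_dw] := leqP (size w) d.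
    have le_w'd : (size w' <= d)%N by rewrite -eq_size.
    by rewrite !(lower_oversize, upper_oversize) // -end_w -end_w'.
  case: d lt_dw => [|d] lt_dw; first by rewrite /lower /upper !easts0.
  have := hw d.+1; have := hw' d.+1; rewrite -eq_size lt_dw /= => /(_ isT) h' /(_ isT) h.
  have := lower_le w d.+1; have := lower_le w' d.+1 => le' le.
  have := @eq_mem (upper w d.+1) d.+1; have := @eq_mem (upper w' d.+1) d.+1.
  have := @eq_mem (lower w d.+1).-1 d.+1; have := @eq_mem (lower w' d.+1).-1 d.+1.
  by lia.
rewrite -(zip_unzip w) -(zip_unzip w'); congr zip; apply: easts_inj.
- by rewrite !size_map.
- by move=> d; have [] := eq_heights d.
- by rewrite !size_map.
- by move=> d; have [] := eq_heights d.
Qed.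

Lemma ltn_addb i u l : (u <= l)%N -> (i < l)%N (+) (i < u)%N = (u <= i < l)%N.
Proof. by move=> le_ul; case: (ltnP i l); case: (ltnP i u); lia. Qed.

Lemma enclosed_polyomino N w : polyomino_word N w -> parallelogram_le N (enclosed w).
Proof.
move=> word_w; case: (word_w) => size_gt1 hw end_w; split; last first.
  move=> [|d].
    rewrite (@card_fset_mem _ _ [::]) // => z; rewrite !inE /=.
    by rewrite addn1 andbF.
  rewrite card_diagonal //; have [lt_dw|le_wd] := ltnP d.+1 (size w).
    by have := hw d.+1 lt_dw; lia.
  by rewrite lower_oversize // upper_oversize // end_w subnn.
have low1 : (upper w 1 < lower w 1)%N by have := hw 1%N; lia.
have := @leq_easts (unzip1 w) 1 (size w); have := @leq_easts (unzip2 w) 1 (size w).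
rewrite -!/(lower w _) -!/(upper w _) => le_up le_low.
exists (lower w (size w)), (size w - lower w (size w))%N.
exists (trace (unzip1 w)), (trace (unzip2 w)).
have count_low : count id (unzip1 w) = lower w (size w).
  by rewrite /lower /easts take_oversize ?size_map.
have count_up : count id (unzip2 w) = lower w (size w).
  by rewrite end_w /upper /easts take_oversize ?size_map.
split.
- by have := lower_le w 1; lia.
- by rewrite /ne_path path_trace last_trace /= count_low size_map eqxx.
- by rewrite /ne_path path_trace last_trace /= count_up size_map eqxx.
- case=> i j; rewrite !mem_visited_trace /= size_map.
  rewrite -/(lower w _) -/(upper w _) => /andP[le_w /eqP eq_i] /andP[_ /eqP eq_i'].
  have [eq0|gt0] := posnP (i + j); first by left; congr pair; lia.
  have [lt_w|ge_w] := ltnP (i + j) (size w); first by have := hw (i + j)%N; lia.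
  have eq_w : (i + j)%N = size w by lia.
  by right; rewrite -eq_w -eq_i; congr pair; lia.
- move=> z; rewrite mem_enclosed // !passes_below_trace -/(lower w _) -/(upper w _).
  rewrite ltn_addb //; have [lt_w|ge_w] := ltnP (z.1 + z.2).+1 (size w).
    by case/andP: (hw (z.1 + z.2).+1 lt_w) => /ltnW.
  by rewrite lower_oversize // upper_oversize // end_w.
Qed.

Lemma ne_path_trace e p : ne_path e p ->
  exists2 l, p = trace l & size l = (e.1 + e.2)%N /\ easts l (size l) = e.1.
Proof.
case/andP=> /trace_path[l ->] /eqP; rewrite last_trace /= !add0n => <- /=.
exists l => //; rewrite /easts take_size; split=> //.
by rewrite subnKC ?count_size.
Qed.

(** The lead of one path over the other changes by at most one per step, so it
    cannot change sign without vanishing. *)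
Lemma noncrossing_easts l1 l2 L :
  (forall d, (0 < d < L)%N -> easts l1 d <> easts l2 d) ->
  (easts l2 1 < easts l1 1)%N ->
  forall d, (0 < d < L)%N -> (easts l2 d < easts l1 d)%N.
Proof.
move=> neq lt1; elim=> // d IHd lt_dL.
have [-> //|d_gt0] := posnP d.
have := IHd; have := neq d.+1 lt_dL; rewrite !eastsS => neq_d.
by have -> : (0 < d < L)%N by [lia]; move=> /(_ isT); lia.
Qed.

(** Paths with a common point visit it at the same time, so the paths of a
    polyomino have different numbers of east steps at every intermediate time. *)
Lemma polyomino_enclosed N al : parallelogram_le N al ->
  exists2 w, polyomino_word N w & al = enclosed w.
Proof.
case=> -[s [t [p1 [p2 [st_gt0 /ne_path_trace[l1 -> [/= size1 end1]]]]]]].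
move=> /ne_path_trace[l2 -> [/= size2 end2]] meet mem_al diag_al.
have neq d : (0 < d < s + t)%N -> easts l1 d <> easts l2 d.
  move=> lt_d eq_d; have := easts_le l1 d => le_d.
  have mem_z l : size l = (s + t)%N -> easts l d = easts l1 d ->
      (easts l1 d, d - easts l1 d)%N \in visited (trace l).
    by move=> size_l eq_l; rewrite mem_visited_trace /= subnKC // eq_l; lia.
  by have [] := meet _ (mem_z l1 size1 erefl) (mem_z l2 size2 (esym eq_d)); case; lia.
(* The definition is symmetric in the two paths; call lower the one that starts
   with an east step. *)
wlog lt1 : l1 l2 size1 size2 end1 end2 neq mem_al {meet} / (easts l2 1 < easts l1 1)%N.
  move=> wlog_lt; case: (ltngtP (easts l1 1) (easts l2 1)) => [lt1|lt1|eq1].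
  - apply: (wlog_lt l2 l1) => // [d /neq neq_d /esym //|z].
    by rewrite mem_al addbC.
  - exact: (wlog_lt l1 l2).
  - by case: (neq 1%N); first lia.
have lt_d := noncrossing_easts neq lt1.
pose w := zip l1 l2.
have w1 : unzip1 w = l1 by rewrite unzip1_zip // size1 size2.
have w2 : unzip2 w = l2 by rewrite unzip2_zip // size1 size2.
have size_w : size w = (s + t)%N by rewrite -size1 -w1 size_map.
have end_w : lower w (size w) = upper w (size w).
  by rewrite /lower /upper w1 w2 size_w -{1}size1 -size2 end1.
have eq_al : al = enclosed w.
  apply/fsetP => z; rewrite mem_al mem_enclosed // !passes_below_trace.
  rewrite /lower /upper w1 w2.
  rewrite ltn_addb //; have [lt_w|ge_w] := ltnP (z.1 + z.2).+1 (s + t).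
    by apply/ltnW/lt_d.
  by rewrite !(@easts_oversize _ (_).+1) ?size1 ?size2 // -size1 end1 size1 -size2 end2.
exists w => //; split => //; first by lia.
move=> [|d] // lt_dw; have := diag_al d.+1; rewrite eq_al card_diagonal //.
have := lt_d d.+1; rewrite -size_w lt_dw /lower /upper w1 w2 => /(_ isT).
by lia.
Qed.

(** * Words as bounded walks *)

(** Stated through east counts rather than by recursion on the height, for
    comparison with [polyomino_word]. *)
Definition is_walk (N h : nat) (w : seq (bool * bool)) : Prop :=
  (forall d, (d < size w)%N -> (upper w d < h + lower w d <= upper w d + N)%N)
  /\ (h + lower w (size w))%N = upper w (size w).

Lemma is_walk_cons N h s w :
  is_walk N h (s :: w) <-> (0 < h <= N)%N /\ is_walk N (next_height h s) w.
Proof.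
rewrite /is_walk /=; split=> [[walk_s end_s]|[lt_h [walk_w end_w]]].
  have := walk_s 0%N isT; rewrite !(lower0, upper0) addn0 add0n => lt_h.
  split=> //; split=> [d lt_d|].
    have := walk_s d.+1 lt_d; rewrite lower_cons upper_cons.
    by rewrite /next_height; case: s.1; case: s.2 => /=; lia.
  move: end_s; rewrite lower_cons upper_cons.
  by rewrite /next_height; case: s.1; case: s.2 => /=; lia.
split=> [[_|d lt_d]|]; first by rewrite !(lower0, upper0); lia.
  have := walk_w d lt_d; rewrite lower_cons upper_cons.
  by rewrite /next_height; case: s.1; case: s.2 => /=; lia.
rewrite lower_cons upper_cons; move: end_w.
by rewrite /next_height; case: s.1; case: s.2 => /=; lia.
Qed.

Lemma is_walk_nil N h : is_walk N h [::] <-> h = 0%N.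
Proof.
rewrite /is_walk !(lower0, upper0) addn0; split=> [[]//|->].
by split.
Qed.

Lemma mem_walks N h L w :
  w \in walks N h L <-> (size w <= L)%N /\ is_walk N h w.
Proof.
elim: L h w => [|L IHL] [|h] [|s w].
- by rewrite is_walk_nil.
- by rewrite is_walk_cons; split=> // -[].
- rewrite is_walk_nil /=; case: ifP => _; by split=> // -[].
- by rewrite /=; case: ifP => _; split=> // -[].
- by rewrite is_walk_nil.
- by rewrite is_walk_cons; split=> // -[_ []].
- rewrite is_walk_nil; split=> [|[]//].
  have [le_hN|lt_Nh] := ltnP h N; last by rewrite /= ltnS lt_Nh.
  by rewrite walksS // => /allpairsPdep[? [? []]].
rewrite is_walk_cons; have [lt_hN|le_Nh] := ltnP h N; last first.
  by rewrite /= ltnS le_Nh; split=> // -[_ []]; lia.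
rewrite walksS // -[(size _ <= _)%N]/(size w <= L)%N.
have steps_all s' : s' \in steps by case: s' => [[] []].
split=> [/allpairsPdep[s' [w' [_ Hw' [-> ->]]]]|[le_wL [_ walk_w]]].
  by have [] := (IHL _ _).1 Hw'.
by apply/allpairsPdep; exists s, w; split => //; apply/IHL.
Qed.

Lemma walks_uniq N h L : uniq (walks N h L).
Proof.
elim: L h => [|L IHL] [|h] //; first by rewrite /=; case: ifP.
have [lt_hN|le_Nh] := ltnP h N; last by rewrite /= ltnS le_Nh.
by rewrite walksS //; apply: allpairs_uniq_dep => // -[s w] [s' w'] _ _ /= [-> ->].
Qed.

(** The paths start from a common point and must separate, with the lower path
    going east. *)
Lemma polyomino_wordE N w : polyomino_word N w <->
  exists2 w', w = (true, false) :: w' & is_walk N 1 w'.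
Proof.
split=> [[size_gt1 hw end_w]|[w' -> [hw end_w]]].
  case: w => [|s w'] // in size_gt1 hw end_w *.
  have eq_s : s = (true, false).
    have := hw 1%N size_gt1; rewrite lower_cons upper_cons lower0 upper0.
    by case: s {size_gt1 hw end_w} => [[] []] //=; lia.
  rewrite eq_s in hw end_w *; exists w' => //; split=> [d lt_d|].
    by have := hw d.+1 lt_d; rewrite lower_cons upper_cons.
  by move: end_w; rewrite lower_cons upper_cons.
split=> [|[|d] // lt_d|].
- by case: w' end_w {hw} => [|s w'] //; rewrite !(lower0, upper0).
- by rewrite lower_cons upper_cons; apply: hw.
- by rewrite lower_cons upper_cons.
Qed.

Lemma walk_mon_cols h w : walk_mon h w 0 = lower w (size w).
Proof.
elim: w h => [|s w IHw] h /=; first by rewrite mnm0E lower0.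
rewrite !mnmDE IHw mnm1E mulmnE mnm1E /= mul0n addn0 lower_cons.
by case: s.1.
Qed.

Lemma walk_mon_rows h w : walk_mon h w 1 = (size w - lower w (size w))%N.
Proof.
elim: w h => [|s w IHw] h /=; first by rewrite mnm0E.
rewrite !mnmDE IHw mnm1E mulmnE mnm1E /= mul0n addn0.
have := lower_le w (size w); rewrite lower_cons.
by case: s.1 => /=; lia.
Qed.

Lemma walk_mon_area N h w : is_walk N h w ->
  walk_mon h w 2 = sumn [seq (h + lower w d - upper w d)%N | d <- iota 0 (size w)].
Proof.
elim: w h => [|s w IHw] h; first by rewrite /= mnm0E.
move=> /is_walk_cons[lt_h walk_w] /=.
rewrite !mnmDE (IHw _ walk_w) mnm1E mulmnE mnm1E /= mul1n.
rewrite lower0 upper0 addn0 subn0.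
have -> : ((if s.1 then 0 else 1) == 2 :> 'I_3) = false by case: s.1.
rewrite add0n; congr (_ + sumn _)%N.
rewrite -[1%N]addn0 iotaDl -map_comp; apply: eq_map => d /=.
rewrite lower_cons upper_cons /next_height.
by case: s.1; case: s.2 => /=; lia.
Qed.

(** The diagonal of time d + 1 of the polyomino has as many squares as the height
    of the remaining walk at time d. *)
Lemma weight_enclosed N w : is_walk N 1 w ->
  weight (enclosed ((true, false) :: w)) = (U_(0%R) + walk_mon 1 w)%MM.
Proof.
move=> walk_w; have word_w : polyomino_word N ((true, false) :: w).
  by apply/polyomino_wordE; exists w.
have end_w : (1 + lower w (size w))%N = upper w (size w) by case: walk_w.
have area_w : area (enclosed ((true, false) :: w)) =
    sumn [seq (1 + lower w d - upper w d)%N | d <- iota 0 (size w)].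
  rewrite area_enclosed -[size (_ :: w)]addn1 iotaD map_cat sumn_cat add0n.
  by rewrite /= lower_cons upper_cons /= -end_w subnn !addn0.
rewrite /weight (pcol_enclosed word_w) (prow_enclosed word_w) area_w.
apply/mnmP => -[[|[|[|//]]] lt_i]; rewrite mnmDE mnm1E.
- rewrite (_ : Ordinal lt_i = 0); last exact: val_inj.
  by rewrite walk_mon_cols.
- rewrite (_ : Ordinal lt_i = 1); last exact: val_inj.
  by rewrite walk_mon_rows.
- rewrite (_ : Ordinal lt_i = 2); last exact: val_inj.
  by rewrite (walk_mon_area walk_w).
Qed.

(** A walk has as many steps as the exponents of x and y in its weight add up to,
    so the truncation by length keeps all walks of a given weight. *)
Lemma walk_series_genfun N : is_genfun (parallelogram_le N) weight (walk_series N).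
Proof.
move=> m; pose L := (mdeg m).+1.
pose good w := (U_(0%R) + walk_mon 1 w)%MM == m.
exists [seq enclosed ((true, false) :: w) | w <- walks N 1 L & good w]; split.
- rewrite map_inj_in_uniq ?filter_uniq ?walks_uniq // => w w'.
  rewrite !mem_filter => /andP[_ /mem_walks[_ walk_w]] /andP[_ /mem_walks[_ walk_w']].
  move=> eq_enc; suff [-> //] : (true, false) :: w = (true, false) :: w'.
  by apply: (@enclosed_inj N) eq_enc; apply/polyomino_wordE; [exists w|exists w'].
- move=> al; split=> [/mapP[w]|[/polyomino_enclosed[w0 /polyomino_wordE[w -> walk_w] ->]]].
    rewrite mem_filter => /andP[/eqP eq_m /mem_walks[_ walk_w]] ->.
    split; last by rewrite (weight_enclosed walk_w).
    by apply: enclosed_polyomino; apply/polyomino_wordE; exists w.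
  rewrite (weight_enclosed walk_w) => eq_m; apply: map_f; rewrite mem_filter.
  rewrite /good eq_m eqxx andTb; apply/mem_walks; split=> //.
  rewrite /L -eq_m mdegD mdeg1 mdegE !big_ord_recl big_ord0.
  rewrite (_ : lift ord0 ord0 = 1); last exact: val_inj.
  rewrite (_ : ord0 = 0) // walk_mon_cols walk_mon_rows.
  rewrite [X in (1 + X)%N]addnA subnKC ?lower_le // add1n.
  by do 2!apply: leqW; apply: leq_addr.
rewrite size_map size_filter /walk_series /walk_poly mulr_sumr raddf_sum /= -sum1_count.
rewrite natr_sum [RHS]big_mkcond; apply: eq_bigr => w _.
by rewrite -mpolyXD mcoeffX /good; case: eqP.
Qed.

Lemma ratvar_neq0 i : ratvar i != 0.
Proof.
rewrite tofrac_eq0; apply/eqP => /(congr1 (mcoeff U_(i)))/eqP.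
by rewrite mcoeffXU eqxx mcoeff0.
Qed.

Lemma ratvar_aperiodic i k : 1 - ratvar i ^+ k.+1 != 0.
Proof.
rewrite -tofracXn -tofrac1 -tofracB tofrac_eq0; apply/eqP => /(congr1 (mcoeff 0%MM))/eqP.
rewrite mcoeffB mcoeff1 eqxx mcoeffXn mcoeff0.
rewrite (_ : (_ == 0%MM) = false) ?subr0 //.
by apply/negPf/eqP => /(congr1 (fun m : 'X_{1..3} => m i)); rewrite mulmnE mnm1E eqxx mnm0E.
Qed.

Theorem corollary6p10 (n : nat) :
  let x := ratvar 0 in
  let y := ratvar 1 in
  let q := ratvar 2 in
  exists f : fps,
    is_genfun (parallelogram_le n.+1) weight f /\
    fps_eq_ratfun f
      (- ((x * \sum_(0 <= k < n.+1) \sum_(0 <= a < (n - k).+1)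
               (-1) ^+ k * x ^+ a * y ^- (k + a) * q ^- ('C(k, 2) + 2 * k)
               * gauss_binom q^-1 (k + a) a * gauss_binom q^-1 (n - a) k)
          / (\sum_(0 <= k < n.+2) \sum_(0 <= a < (n.+1 - k).+1)
               (-1) ^+ k * x ^+ a * y ^- (k + a) * q ^- ('C(k, 2) + k)
               * gauss_binom q^-1 (k + a) a
               * gauss_binom q^-1 (n.+1 - a) k))).
Proof.
move=> x y q; exists (walk_series n.+1); split; first exact: walk_series_genfun.
pose K := @continuant {mpoly int[3]} 'X_0 'X_1 'X_2.
exists ('X_0 * 'X_1 * 'X_2 * K n 2), (K n.+1 1%N).
split; [exact: continuant_neq0 | | exact: walk_series_rational].
have tofracK k h : tofrac (K k h) = continuant x y q k h by exact: rmorph_continuant.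
have K_neq0 : continuant x y q n.+1 1 != 0.
  by rewrite -tofracK tofrac_eq0 continuant_neq0.
have y_neq0 : y != 0 by exact: ratvar_neq0.
have q_neq0 : q != 0 by exact: ratvar_neq0.
have q_aperiodic i : 1 - q ^+ i.+1 != 0 by exact: ratvar_aperiodic.
have ratio := continuant_ratio y_neq0 q_neq0 q_aperiodic K_neq0.
transitivity (- (x * closed_sum x y q n 2 / closed_sum x y q n.+1 1)).
  congr (- (_ / _)); apply: eq_bigr => k _; apply: eq_bigr => a _.
  by rewrite mul1n.
by rewrite -ratio !tofracM !tofracK.
Qed.
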